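(* Let $G$ be a connected graph with $m$ edges. Then $$MS_2(G)\ \le\ \frac12\,MSD^{3/2}(G)-\frac{1}{2m}\,\mathrm{irr}_{\mathrm{Tr}}(G)^2,$$ with equality if and only if $|\sigma(u)-\sigma(v)|$ is constant over all edges $uv\in E(G)$.
   Context: All graphs are finite and simple. $d(u)$ is the degree of a vertex $u$; $d(u,v)$ is the graph distance; the transmission of $v$ is $\sigma(v)=\sum_{u\in V(G)}d(v,u)$. Define $MS_2(G)=\sum_{uv\in E(G)}\sigma(u)\sigma(v)$, $MSD^{3/2}(G)=\sum_{u\in V(G)}d(u)\sigma(u)^2$ (the superscript is an index parameter, not a power), and $\mathrm{irr}_{\mathrm{Tr}}(G)=\sum_{uv\in E(G)}|\sigma(u)-\sigma(v)|$. *)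

(* Defs.v *)
From mathcomp Require Import all_boot all_order all_algebra.

Set Implicit Arguments.
Unset Strict Implicit.
Unset Printing Implicit Defensive.

Import Order.TTheory GRing.Theory Num.Theory.
Local Open Scope ring_scope.

Record sgraph := SGraph {
  vertex :> finType;
  adj : rel vertex;
  adj_sym : symmetric adj;
  adj_irr : irreflexive adj }.

Definition edges (G : sgraph) : {set {set G}} :=
  [set A | [exists u : G, exists v : G, adj u v && (A == [set u; v])]].

Definition connected (G : sgraph) : Prop :=
  (0 < #|G|)%N /\ forall u v : G, connect (@adj G) u v.

Definition deg (G : sgraph) (u : G) : nat := #|[set v | adj u v]|.

Definition has_walk (G : sgraph) (u v : G) (n : nat) : bool :=
  [exists p : n.-tuple G, path (@adj G) u p && (last u p == v)].

(* Least length of a walk from u to v. A shortest walk has length < #|G|;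
   vertices in different components get the value #|G|. *)
Definition dist (G : sgraph) (u v : G) : nat :=
  find (has_walk u v) (iota 0 #|G|).

Lemma has_walkP (G : sgraph) (u v : G) n :
  reflect (exists p, [/\ path (@adj G) u p, last u p = v & size p = n])
          (has_walk u v n).
Proof.
apply: (iffP existsP) => [[p /andP[up /eqP vp]]|[p [up vp /eqP sp]]].
  by exists p; rewrite size_tuple.
by exists (Tuple sp); rewrite /= up vp eqxx.
Qed.

Lemma dist_le (G : sgraph) (u v : G) p :
  path (@adj G) u p -> last u p = v -> (dist u v <= size p)%N.
Proof.
move=> up vp; rewrite leqNgt; apply/negP => lt_p.
have lt_pG : (size p < #|G|)%N.
  by apply: leq_trans lt_p _; rewrite -[leqRHS](size_iota 0) find_size.
have /negP[] := negbT (before_find 0%N lt_p).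
by rewrite nth_iota //; apply/has_walkP; exists p.
Qed.

Lemma dist_walk (G : sgraph) (u v : G) : connect (@adj G) u v ->
  exists p, [/\ path (@adj G) u p, last u p = v & size p = dist u v].
Proof.
case/connectP => p0 up0 ->; case/shortenP: up0 => p up uniq_p _.
have lt_p : (size p < #|G|)%N.
  by have := max_card (mem (u :: p)); rewrite (card_uniqP uniq_p).
have hasw : has (has_walk u (last u p)) (iota 0 #|G|).
  apply/hasP; exists (size p); first by rewrite mem_iota.
  by apply/has_walkP; exists p.
apply/has_walkP; have := nth_find 0%N hasw.
by rewrite nth_iota // -[ltnRHS](size_iota 0) -has_find.
Qed.

Definition transmission (G : sgraph) (v : G) : nat :=
  (\sum_(u : G) dist v u)%N.

(* Value of f at the two ends of A; meaningful for symmetric f only, since the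
   order of the ends is the arbitrary one of enum. *)
Definition at_ends (G : sgraph) (R : nmodType) (f : G -> G -> R)
    (A : {set G}) : R :=
  if enum A is [:: u; v] then f u v else 0.

Definition edge_sum (G : sgraph) (R : nmodType) (f : G -> G -> R) : R :=
  \sum_(A in edges G) at_ends f A.

Lemma at_endsE (G : sgraph) (R : nmodType) (f : G -> G -> R) (u v : G) :
  (forall x y, f x y = f y x) -> adj u v -> at_ends f [set u; v] = f u v.
Proof.
move=> fC uv; have neq_uv : u != v.
  by apply/eqP => eq_uv; rewrite eq_uv adj_irr in uv.
rewrite /at_ends; have := enum_uniq [set u; v].
have : size (enum [set u; v]) = 2 by rewrite -cardE cards2 neq_uv.
have := mem_enum [set u; v].
case: (enum _) => [|x [|y []]] //= in_xy _; rewrite inE andbT => neq_xy.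
have := in_xy u; have := in_xy v; rewrite !inE !eqxx orbT /=.
case/orP=> /eqP v_eq /orP[] /eqP u_eq; rewrite u_eq v_eq ?eqxx // in neq_uv *.
Qed.

Section Indices.

Variables (R : realFieldType) (G : sgraph).

Definition tr (u : G) : R := (transmission u)%:R.

Definition MS2 : R := edge_sum (fun u v : G => tr u * tr v).

Definition MSD32 : R := \sum_(u : G) (deg u)%:R * tr u ^+ 2.

Definition irrTr : R := edge_sum (fun u v : G => `|tr u - tr v|).

End Indices.

Arguments tr R {G} u.

(* Main.v *)
Require Import Defs.
From mathcomp Require Import all_boot all_order all_algebra.
From mathcomp Require Import ring lra.

Import Order.TTheory GRing.Theory Num.Theory.
Local Open Scope ring_scope.

(** Counting each vertex once per incident edge turns the sum of
    [deg u * tr u ^+ 2] over the vertices into the sum of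
    [tr u ^+ 2 + tr v ^+ 2] over the edges ([sum_deg_edge_sum]).  As
    [tr u ^+ 2 + tr v ^+ 2 = 2 * (tr u * tr v) + `|tr u - tr v| ^+ 2], the
    difference [MSD32 - 2 * MS2] is the sum Q of the squares of the edge gaps
    [`|tr u - tr v|] ([MSD32_gaps]).  Since [irrTr] is the sum S of the same
    gaps, the inequality says that S ^+ 2 / m <= Q.  This is the nonnegativity
    of the variance of the gaps over the m edges, and the variance vanishes
    exactly when the gaps are all equal ([sqr_sum_le], [sqr_sum_eq]). *)

Section SquareOfSum.

Variables (R : realFieldType) (T : finType) (E : {set T}) (f : T -> R).

Let S := \sum_(i in E) f i.
Let mean := S / #|E|%:R.

Lemma card_mean : #|E|%:R * mean = S.
Proof.
have [E0|E0] := eqVneq #|E| 0%N; last by rewrite mulrC divfK ?pnatr_eq0.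
by rewrite E0 mul0r /S (cards0_eq E0) big_set0.
Qed.

(** The usual formula for the variance.  It survives an empty [E], because
    [card_mean] does: the sum is then zero. *)
Lemma sum_sqr_dev :
  \sum_(i in E) (f i - mean) ^+ 2 = \sum_(i in E) f i ^+ 2 - S ^+ 2 / #|E|%:R.
Proof.
rewrite (eq_bigr (fun i => f i ^+ 2 - 2 * mean * f i + mean ^+ 2)); last first.
  by move=> i _; ring.
rewrite big_split sumrB /= -mulr_sumr sumr_const -/S -[_ *+ #|E|]mulr_natl.
have -> : S ^+ 2 / #|E|%:R = S * mean by rewrite /mean mulrA -expr2.
have -> : #|E|%:R * mean ^+ 2 = S * mean by rewrite expr2 mulrA card_mean.
by ring.
Qed.

Lemma sqr_sum_le : S ^+ 2 / #|E|%:R <= \sum_(i in E) f i ^+ 2.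
Proof. by rewrite -subr_ge0 -sum_sqr_dev sumr_ge0 // => i _; apply: sqr_ge0. Qed.

Lemma sqr_sum_eq :
  S ^+ 2 / #|E|%:R = \sum_(i in E) f i ^+ 2 <->
  exists c, forall i, i \in E -> f i = c.
Proof.
split=> [/esym/eqP|[c fc]].
  rewrite -subr_eq0 -sum_sqr_dev psumr_eq0 => [/allP dev0|i _]; last first.
    exact: sqr_ge0.
  exists mean => i Ei; apply/eqP; rewrite -subr_eq0 -sqrf_eq0.
  exact: implyP (dev0 i (mem_index_enum i)) Ei.
have Sc : S = #|E|%:R * c.
  by rewrite /S (eq_bigr (fun=> c)) // sumr_const mulr_natl.
rewrite (eq_bigr (fun=> c ^+ 2)) => [|i /fc-> //]; rewrite sumr_const Sc.
have [->|E0] := eqVneq #|E| 0%N; first by rewrite !mul0r expr2 !mul0r.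
by rewrite -mulr_natl; field; rewrite pnatr_eq0.
Qed.

End SquareOfSum.

Section Edges.

Variable G : sgraph.

Lemma edgesP {A : {set G}} :
  reflect (exists u v : G, adj u v /\ A = [set u; v]) (A \in edges G).
Proof.
rewrite inE; apply: (iffP existsP) => [[u /existsP[v /andP[uv /eqP]]]|].
  by exists u, v.
by case=> u [v [uv ->]]; exists u; apply/existsP; exists v; rewrite uv eqxx.
Qed.

Lemma adj_neq {u v : G} : adj u v -> u != v.
Proof. by apply: contraTneq => ->; rewrite adj_irr. Qed.

Lemma deg_edges (u : G) : deg u = #|[set A in edges G | u \in A]|.
Proof.
rewrite /deg -(card_in_imset (f := fun v => [set u; v])); last first.
  move=> v w; rewrite !inE => uv _ /setP/(_ v).
  by rewrite !inE eqxx orbT eq_sym (negPf (adj_neq uv)) => /esym/eqP.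
apply: eq_card => A; apply/imsetP/setIdP => [[v]|[/edgesP[x [y [xy ->]]]]].
  rewrite inE => uv ->; split; last by rewrite !inE eqxx.
  by apply/edgesP; exists u, v.
rewrite !inE => /orP[] /eqP->; first by exists y; rewrite ?inE.
by exists x; rewrite ?inE 1?adj_sym // setUC.
Qed.

(** Double counting of the incident pairs (vertex, edge), each one weighted by
    the value of [g] at its vertex. *)
Lemma sum_deg_edge_sum (R : pzRingType) (g : G -> R) :
  \sum_(u : G) (deg u)%:R * g u = edge_sum (fun u v : G => g u + g v).
Proof.
under eq_bigr => u _.
  rewrite deg_edges mulr_natl -sumr_const.
  under eq_bigl => A do rewrite inE.
  over.
rewrite (exchange_big_dep (mem (edges G))) /= => [|u A _ /andP[] //].
apply: eq_bigr => A EA; have /edgesP[u [v [uv defA]]] := EA.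
rewrite defA at_endsE // => [|x y]; last exact: addrC.
rewrite -defA; under eq_bigl => x do rewrite EA defA.
by rewrite big_setU1 ?inE ?adj_neq //= big_set1.
Qed.

End Edges.

Section Gaps.

Variables (R : realFieldType) (G : sgraph).

Definition gap (A : {set G}) : R :=
  at_ends (fun u v : G => `|tr R u - tr R v|) A.

Lemma gapE {u v : G} : adj u v -> gap [set u; v] = `|tr R u - tr R v|.
Proof. by move=> uv; rewrite /gap at_endsE // => x y; apply: distrC. Qed.

Lemma MSD32_gaps :
  MSD32 R G = 2 * MS2 R G + \sum_(A in edges G) gap A ^+ 2.
Proof.
rewrite /MSD32 sum_deg_edge_sum mulr_sumr -big_split /=.
apply: eq_bigr => _ /edgesP[u [v [uv ->]]].
rewrite gapE // !at_endsE // => [|x y|x y]; [|exact: mulrC|exact: addrC].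
by rewrite real_normK ?num_real //; ring.
Qed.

Lemma gap_const {c} :
  (forall A, A \in edges G -> gap A = c) <->
  (forall u v : G, adj u v -> `|tr R u - tr R v| = c).
Proof.
split=> [gapc u v uv|gapc _ /edgesP[u [v [uv ->]]]].
  by rewrite -gapE // gapc //; apply/edgesP; exists u, v.
by rewrite gapE // gapc.
Qed.

End Gaps.

Arguments gap {R G} A.

Theorem proposition10 (R : realFieldType) (G : sgraph) (m : nat)
    (hG : connected G) (hm : #|edges G| = m) :
  MS2 R G <= 1 / 2 * MSD32 R G - 1 / (2 * m%:R) * irrTr R G ^+ 2 /\
  (MS2 R G = 1 / 2 * MSD32 R G - 1 / (2 * m%:R) * irrTr R G ^+ 2 <->
   exists c : R, forall u v : G, adj u v -> `|tr R u - tr R v| = c).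
Proof.
have le_Q := sqr_sum_le R _ (edges G) (@gap R G).
have eq_Q := sqr_sum_eq R _ (edges G) (@gap R G).
rewrite hm -[\sum_(A in edges G) gap A]/(irrTr R G) in le_Q eq_Q.
have -> : 1 / (2 * m%:R) * irrTr R G ^+ 2 = 1 / 2 * (irrTr R G ^+ 2 / m%:R).
  by rewrite !mul1r invfM -mulrA [m%:R^-1 * _]mulrC.
rewrite MSD32_gaps; split; first by lra.
split=> [eq_MS2|[c /gap_const gapc]].
  have /eq_Q[c /gap_const gapc] :
      irrTr R G ^+ 2 / m%:R = \sum_(A in edges G) gap A ^+ 2 by lra.
  by exists c.
have -> : irrTr R G ^+ 2 / m%:R = \sum_(A in edges G) gap A ^+ 2.
  by apply/eq_Q; exists c.
by lra.
Qed.
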